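(* Let $\mathbf{X}=(X_1,\dots,X_n)\in L^1(\Omega,\mathcal{F},\mathbb{P})^n$ with $X_i\ge0$, let $0<\beta_1<\cdots<\beta_n$, $\beta_0:=0$, $\alpha\in(0,1)$ and $\lambda>0$. Put $K:=\frac{\lambda}{1-\alpha}$ and $S:=\sum_{i=1}^n X_i$. Let $P(\lambda)$ be the set of minimizers of $$\sum_{i=1}^n\beta_i\,\mathbb{E}(R_i)+\lambda\,\mathrm{CVaR}_\alpha\Big(\sum_{i=1}^n(X_i-R_i)\Big)$$ over all random vectors $\mathbf{R}=(R_1,\dots,R_n)$ with $0\le R_i\le X_i$ for all $i$. Define, for $q\in\mathbb{R}$, $$J_-'(q):=\sum_{i=1}^n\big((K-\beta_i)_+-(K-\beta_{i-1})_+\big)\,\mathbb{P}\Big(q\le\sum_{j=i}^nX_j\Big)+\lambda,$$ $$J_+'(q):=\sum_{i=1}^n\big((K-\beta_i)_+-(K-\beta_{i-1})_+\big)\,\mathbb{P}\Big(q<\sum_{j=i}^nX_j\Big)+\lambda .$$ Then $P(\lambda)$ is the set of all $\mathbf{R}^*=(R_1^*,\dots,R_n^* )$ for which there is a $q\in[0,\mathrm{VaR}_\alpha(S)]$ satisfying $$\begin{cases}J_-'(q)\le 0\le J_+'(q), & \text{if } q\in(0,\mathrm{VaR}_\alpha(S)),\\ J_+'(q)\ge 0, & \text{if } q=0,\\ J_-'(q)\le 0, & \text{if } q=\mathrm{VaR}_\alpha(S),\end{cases}$$ such that for each $i=1,\dots,n$: 1. if $\beta_i\ne K$, then $$R_i^*=\mathbf{1}(\beta_i<K)\Big(\Big(S-\sum_{j=1}^{i-1}X_j-q\Big)_+\wedge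 X_i\Big);$$ 2. if $\beta_i=K$, then pointwise $$0\le R_i^*\le\Big(S-\sum_{j=1}^{i-1}X_j-q\Big)_+\wedge X_i .$$
   Context: $(\Omega,\mathcal{F},\mathbb{P})$ is a probability space; relations between random variables hold $\mathbb{P}$-almost surely, and the $R_i$ are arbitrary random variables on this space (not necessarily $\sigma(\mathbf{X})$-measurable). For an integrable random variable $Z$ with distribution function $F_Z$, $\mathrm{VaR}_\alpha(Z):=\inf\{x: F_Z(x)\ge\alpha\}$ and $\mathrm{CVaR}_\alpha(Z):=\frac{1}{1-\alpha}\int_\alpha^1\mathrm{VaR}_t(Z)\,dt$. Notation: $x_+=\max(x,0)$, $x\wedge y=\min(x,y)$; $\mathbf{1}(\beta_i<K)$ is $1$ if $\beta_i<K$ and $0$ otherwise.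
   Formalization: If VaR_α(S)=0, so that q=0 is both endpoints, only one of the conditions for q=0 and q=VaR_α(S) is required; requiring both is false, e.g. n=1, X_1=0, β_1<λ, where J_-'(0)=λ-β_1>0 although R=0 is the minimizer. *)

(* Defs.v *)
From HB Require Import structures.
From mathcomp Require Import all_boot all_order all_algebra.
From mathcomp Require Import all_classical all_reals all_analysis.
From mathcomp Require Import measurable_realfun.
Set Implicit Arguments.
Unset Strict Implicit.
Unset Printing Implicit Defensive.
Import Order.TTheory GRing.Theory Num.Theory.
Import numFieldNormedType.Exports.
Local Open Scope classical_set_scope.
Local Open Scope ring_scope.

(* Conventions: the random vectors (X_1, ..., X_n), (R_1, ..., R_n) are       *)
(* families indexed by i : 'I_n = {0, ..., n-1}, so X i is X_{i+1}.  The      *)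
(* coefficients keep their usual numbering: beta : nat -> R, where            *)
(* beta 0 = beta_0, ..., beta n = beta_n, and later values are never used.    *)
(* Thus the coefficient attached to X i is beta i.+1, and its predecessor     *)
(* is beta i.                                                                 *)

Section risk_measures.
Context d (T : measurableType d) (R : realType) (P : probability T R).

(* Extended-real valued, with inf set0 = +oo, which can only happen when
   alpha >= 1. *)
Definition VaR (alpha : R) (Z : {RV P >-> R}) : \bar R :=
  ereal_inf [set x%:E | x in [set x : R | (alpha%:E <= cdf Z x)%E]].

Definition CVaR (alpha : R) (Z : {RV P >-> R}) : \bar R :=
  (((1 - alpha)^-1)%:E
     * \int[lebesgue_measure]_(t in `[alpha, 1%R]) VaR t Z)%E.

End risk_measures.

Arguments VaR {d T R} P alpha Z.
Arguments CVaR {d T R} P alpha Z.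

Section problem.
Context d (T : measurableType d) (R : realType) (P : probability T R).
Variables (n : nat) (X : 'I_n -> {RV P >-> R}) (beta : nat -> R).
Variables (alpha lambda : R).

Definition admissible (Rs : 'I_n -> {RV P >-> R}) : Prop :=
  forall i, {ae P, forall w, 0 <= Rs i w <= X i w}.

Definition objective (Rs : 'I_n -> {RV P >-> R}) : \bar R :=
  (\sum_(i < n) (beta i.+1)%:E * 'E_P[Rs i]
   + lambda%:E * CVaR P alpha (\sum_(i < n) (X i - Rs i))%R)%E.

Definition minimizers : set ('I_n -> {RV P >-> R}) :=
  [set Rs | admissible Rs /\
    forall Rs', admissible Rs' -> (objective Rs <= objective Rs')%E].

Definition total_loss : {RV P >-> R} := \sum_(i < n) X i.

Definition cutoff : R := lambda / (1 - alpha).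

Definition pos_part (x : R) : R := Num.max x 0.

Definition Jminus (q : R) : R :=
  \sum_(i < n) (pos_part (cutoff - beta i.+1) - pos_part (cutoff - beta i))
    * fine (P [set w | q <= \sum_(j < n | (i <= j)%N) X j w])
  + lambda.

Definition Jplus (q : R) : R :=
  \sum_(i < n) (pos_part (cutoff - beta i.+1) - pos_part (cutoff - beta i))
    * fine (P [set w | q < \sum_(j < n | (i <= j)%N) X j w])
  + lambda.

(* First-order condition at q, by cases on the position of q in
   [0, VaR_alpha(S)].  In the degenerate case VaR_alpha(S) = 0 both boundary
   cases apply to q = 0, and it suffices that one of the two holds. *)
Definition first_order (q : R) : Prop :=
  [\/ (0 < q%:E < VaR P alpha total_loss)%E /\ Jminus q <= 0 <= Jplus q,
      q = 0 /\ 0 <= Jplus q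
    | q%:E = VaR P alpha total_loss /\ Jminus q <= 0].

Definition layer (q : R) (i : 'I_n) (w : T) : R :=
  Num.min (pos_part (total_loss w - \sum_(j < n | (j < i)%N) X j w - q)) (X i w).

End problem.

(* Main.v *)
Require Import Defs.
From HB Require Import structures.
From mathcomp Require Import all_boot all_order all_algebra.
From mathcomp Require Import all_classical all_reals all_analysis.
From mathcomp Require Import measurable_realfun.
From mathcomp Require Import lra ring.
Import Order.TTheory GRing.Theory Num.Theory.
Import numFieldNormedType.Exports.
Local Open Scope classical_set_scope.
Local Open Scope ring_scope.

(* By the Rockafellar-Uryasev formula, CVaR(Z) is the minimum over q of       *)
(* q + E[(Z - q)_+] / (1 - alpha), attained at q = VaR(Z).  Hence the         *)
(* objective at Rs is the minimum over q of cost Rs q = sum_i beta_i E[R_i] + *)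
(* lambda q + K E[(sum_i (X_i - R_i) - q)_+].  Abel summation writes          *)
(* cost Rs q as J q plus the expectation of a nonnegative excess, where J is  *)
(* convex with one-sided derivatives Jminus and Jplus; the excess vanishes    *)
(* exactly when Rs follows the layers at q.  So Rs is a minimizer iff its     *)
(* excess vanishes a.s. at some minimizer q of J.  Since                      *)
(* 0 <= sum_i (X_i - R_i) <= S a.s., only q in [0, VaR(S)] matter.            *)

(** Apart from the choice of [q], the argument is pathwise. Write m_i = (K - beta_i)_+ and e =
    (sum_i (x_i - r_i) - q)_+. Because beta_i = (beta_i - K)_+ + K - m_i and m_0 = K, Abel summation
    turns sum_i beta_i r_i + K e into sum_i (m_{i-1} - m_i) (sum_{j >= i} x_j - q)_+ plus an excess
    ([cost_excess]), and only the excess depends on r. For q >= 0 and 0 <= r <= x the excess is a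
    sum of nonnegative terms ([excess_ge0]); it vanishes exactly when r follows the layers at q
    ([excess_eq0_layered], [layered_excess_eq0]).

    Taking expectations ([cost_gap]) decouples the joint minimization over treaties and [q]:
    minimize [J], then follow the layers at the minimizer. [CVaR_stoploss] and [CVaR_le_stoploss]
    link this joint problem to the objective; [first_order_min] and [min_first_order] express the
    minimality of [q] through one-sided derivatives. *)

Section pos_part.
Context {R : realType}.
Implicit Types x y q : R.

Lemma pos_part_ge0 x : 0 <= pos_part x.
Proof. by rewrite /pos_part le_max lexx orbT. Qed.

Lemma pos_part_ge x : x <= pos_part x.
Proof. by rewrite /pos_part le_max lexx. Qed.

Lemma pos_part_id x : 0 <= x -> pos_part x = x.
Proof. by move=> x0; rewrite /pos_part; apply/max_idPl. Qed.

Lemma pos_part_eq0 x : x <= 0 -> pos_part x = 0.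
Proof. by move=> x0; rewrite /pos_part; apply/max_idPr. Qed.

Lemma le_pos_part x y : x <= y -> pos_part x <= pos_part y.
Proof. by move=> xy; rewrite /pos_part ge_max !le_max xy lexx orbT. Qed.

(** A layer is a difference of two stop losses, so consecutive layers telescope. *)
Lemma min_pos_part x y q : 0 <= x ->
  Num.min (pos_part (x + y - q)) x = pos_part (x + y - q) - pos_part (y - q).
Proof.
move=> x0; have [yq|yq] := leP 0 (y - q).
  rewrite (pos_part_id _ yq) pos_part_id ?(min_idPr _)//; lra.
rewrite (pos_part_eq0 (y - q)) ?subr0 ?(ltW yq)//; apply/min_idPl.
by rewrite /pos_part ge_max x0 andbT; lra.
Qed.

End pos_part.

(** * Tail sums and Abel summation *)

Section tail.
Context {R : realType} {n : nat}.
Implicit Types x y : 'I_n -> R.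

Definition tail x (m : nat) : R := \sum_(j < n | (m <= j)%N) x j.

Lemma tail0 x : tail x 0 = \sum_(j < n) x j. Proof. exact: eq_bigl. Qed.

Lemma tail_n x : tail x n = 0.
Proof. by rewrite /tail big1// => j; rewrite leqNgt ltn_ord. Qed.

Lemma tailS x (i : 'I_n) : tail x i = x i + tail x i.+1.
Proof.
rewrite /tail (bigD1 i)//=; congr (_ + _); apply: eq_bigl => j.
by rewrite ltn_neqAle andbC eq_sym.
Qed.

Lemma tail_ge0 x m : (forall i, 0 <= x i) -> 0 <= tail x m.
Proof. by move=> x0; apply: sumr_ge0. Qed.

Lemma tailE x (i : nat) :
  tail x i = \sum_(j < n) x j - \sum_(j < n | (j < i)%N) x j.
Proof.
rewrite (bigID (fun j : 'I_n => (j < i)%N))/= addrAC subrr add0r.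
by apply: eq_bigl => j; rewrite -leqNgt.
Qed.

Lemma sum_telescope (a : nat -> R) m : \sum_(i < m) (a i - a i.+1) = a 0%N - a m.
Proof.
rewrite -(big_mkord xpredT (fun i => a i - a i.+1)).
by rewrite (telescope_sumr_eq (fun i => - a i))// => [|i _]; lra.
Qed.

(** Abel summation: [x j] occurs in the tails of index i <= j, whose weights telescope. *)
Lemma sum_mul_tail (a : nat -> R) x :
  \sum_(i < n) (a i - a i.+1) * tail x i = \sum_(i < n) (a 0%N - a i.+1) * x i.
Proof.
under eq_bigr do rewrite /tail mulr_sumr.
rewrite (exchange_big_dep xpredT)//=; apply: eq_bigr => j _.
rewrite -mulr_suml; congr (_ * _).
rewrite (eq_bigl (fun i : 'I_n => (i < j.+1)%N))//.
rewrite -(big_ord_widen _ (fun i => a i - a i.+1) (ltn_ord j)).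
exact: sum_telescope.
Qed.

End tail.

(** * The pathwise allocation problem *)

Section allocation.
Context {R : realType} {n : nat}.
Variables (beta : nat -> R) (K : R).
Hypothesis K_gt0 : 0 < K.
Hypothesis beta0 : beta 0%N = 0.
Hypothesis beta_incr : forall i, (i < n)%N -> beta i < beta i.+1.
Implicit Types (x r : 'I_n -> R) (q : R).

Definition margin i := pos_part (K - beta i).

Definition retained x r q := pos_part (\sum_(i < n) (x i - r i) - q).

Definition layer_part x q (i : 'I_n) :=
  Num.min (pos_part (tail x i - q)) (x i).

Definition layered x q r := forall i : 'I_n,
  (beta i.+1 != K -> r i = (beta i.+1 < K)%R%:R * layer_part x q i) /\
  (beta i.+1 = K -> 0 <= r i <= layer_part x q i).

(** Three penalties: ceding a risk priced above [K]; retaining loss beyond [q] although all prices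
    are below [K]; and, for each tail of risks, the amount by which ceded plus retained loss
    surpasses the stop loss of that tail. *)
Definition excess x r q :=
  \sum_(i < n) pos_part (beta i.+1 - K) * r i +
  margin n * retained x r q +
  \sum_(i < n) (margin i - margin i.+1) *
    (tail r i + retained x r q - pos_part (tail x i - q)).

Let margin0 : margin 0%N = K.
Proof. by rewrite /margin beta0 subr0 pos_part_id// ltW. Qed.

(** Each price splits as (beta_i - K)_+ + (K - m_i). Abel summation moves the second part onto
    tails, and [K * e] is distributed over the same weights, which sum to [K - margin n]. *)
Lemma cost_excess x r q :
  \sum_(i < n) beta i.+1 * r i + K * retained x r q =
  \sum_(i < n) (margin i - margin i.+1) * pos_part (tail x i - q) +
  excess x r q.
Proof.
rewrite /excess; set e := retained x r q.
have -> : \sum_(i < n) (margin i - margin i.+1) *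
    (tail r i + e - pos_part (tail x i - q)) =
  \sum_(i < n) (margin i - margin i.+1) * tail r i + (K - margin n) * e -
  \sum_(i < n) (margin i - margin i.+1) * pos_part (tail x i - q).
  have <- : \sum_(i < n) (margin i - margin i.+1) = K - margin n.
    by rewrite sum_telescope margin0.
  rewrite mulr_suml -big_split/= -sumrB; apply: eq_bigr => i _.
  by rewrite mulrBr mulrDr.
rewrite sum_mul_tail margin0.
have -> : \sum_(i < n) beta i.+1 * r i =
    \sum_(i < n) pos_part (beta i.+1 - K) * r i +
    \sum_(i < n) (K - margin i.+1) * r i.
  rewrite -big_split/=; apply: eq_bigr => i _; rewrite -mulrDl; congr (_ * _).
  rewrite /margin; have [h|h] := leP 0 (K - beta i.+1).
    by rewrite (pos_part_id _ h) pos_part_eq0; lra.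
  by rewrite (pos_part_eq0 (K - _)) ?(ltW h)// pos_part_id; lra.
lra.
Qed.

Lemma margin_le (i : 'I_n) : margin i.+1 <= margin i.
Proof. by apply: le_pos_part; have := beta_incr _ (ltn_ord i); lra. Qed.

Let margin_lt (i : 'I_n) : beta i < K -> margin i.+1 < margin i.
Proof.
move=> biK; rewrite /margin (pos_part_id (K - beta i)); last by lra.
by rewrite /pos_part gt_max; have := beta_incr _ (ltn_ord i); lra.
Qed.

Section bounds.
Variables (x : 'I_n -> R) (q : R).
Hypothesis q_ge0 : 0 <= q.
Hypothesis x_ge0 : forall i, 0 <= x i.

Lemma layer_partE i : layer_part x q i =
  pos_part (tail x i - q) - pos_part (tail x i.+1 - q).
Proof. by rewrite /layer_part tailS min_pos_part. Qed.

Lemma layer_part_bound i : 0 <= layer_part x q i <= x i.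
Proof. by rewrite /layer_part le_min pos_part_ge0 x_ge0/= ge_min lexx orbT. Qed.

Lemma layered_bound r i : layered x q r -> 0 <= r i <= layer_part x q i.
Proof.
move=> /(_ i)[lr eqr]; have /andP[l0 _] := layer_part_bound i.
have [/eqr//|/lr ->] := eqVneq (beta i.+1) K.
by case: (_ < _); rewrite ?mul1r ?mul0r l0 lexx.
Qed.

Let tail_n_q : pos_part (tail x n - q) = 0.
Proof. by rewrite tail_n sub0r pos_part_eq0// oppr_le0. Qed.

Let sum_layer_part : \sum_(i < n) layer_part x q i = pos_part (tail x 0 - q).
Proof.
under eq_bigr do rewrite layer_partE.
by rewrite (sum_telescope (fun i => pos_part (tail x i - q))) tail_n_q subr0.
Qed.

(** Dropping the nonnegative differences x_j - r_j for j < m bounds the retained loss below by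
    [tail x m - tail r m - q]. *)
Let excess_term_ge0 r m : (forall i, 0 <= r i <= x i) ->
  0 <= tail r m + retained x r q - pos_part (tail x m - q).
Proof.
move=> rx; have t0 : 0 <= tail r m by apply: tail_ge0 => i; case/andP: (rx i).
have e0 := pos_part_ge0 (\sum_(i < n) (x i - r i) - q).
rewrite subr_ge0 /pos_part ge_max addr_ge0// andbT.
suff : tail x m - tail r m - q <= retained x r q by lra.
apply: le_trans (pos_part_ge _).
rewrite lerD2r !tailE sumrB.
suff : \sum_(j < n | (j < m)%N) r j <= \sum_(j < n | (j < m)%N) x j by lra.
by apply: ler_sum => i _; case/andP: (rx i).
Qed.

Lemma excess_ge0 r : (forall i, 0 <= r i <= x i) -> 0 <= excess x r q.
Proof.
move=> rx; rewrite /excess !addr_ge0 ?mulr_ge0 ?pos_part_ge0//.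
  by apply: sumr_ge0 => i _; rewrite mulr_ge0 ?pos_part_ge0//; case/andP: (rx i).
apply: sumr_ge0 => i _; rewrite mulr_ge0//; first by rewrite subr_ge0 margin_le.
exact: excess_term_ge0.
Qed.

(** All penalties vanish term by term. Where [beta i < K] the weight is strictly positive and yields
    an identity between tails; subtracting consecutive identities isolates [r i]. A price above [K]
    forces [r i = 0]. *)
Lemma excess_eq0_layered r : (forall i, 0 <= r i <= x i) ->
  excess x r q = 0 -> layered x q r.
Proof.
move=> rx ex0; set e := retained x r q in ex0.
have e0 : 0 <= e by exact: pos_part_ge0.
pose A := \sum_(i < n) pos_part (beta i.+1 - K) * r i.
pose B := margin n * e.
pose C := \sum_(i < n) (margin i - margin i.+1) *
    (tail r i + e - pos_part (tail x i - q)).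
have A_ge0 (i : 'I_n) : true -> 0 <= pos_part (beta i.+1 - K) * r i.
  by move=> _; rewrite mulr_ge0 ?pos_part_ge0//; case/andP: (rx i).
have C_ge0 (i : 'I_n) : true -> 0 <= (margin i - margin i.+1) *
    (tail r i + e - pos_part (tail x i - q)).
  move=> _; rewrite mulr_ge0//; first by rewrite subr_ge0 margin_le.
  exact: excess_term_ge0.
have A0 : 0 <= A by exact: sumr_ge0.
have B0 : 0 <= B by rewrite mulr_ge0 ?pos_part_ge0.
have C0 : 0 <= C by exact: sumr_ge0.
have [Aeq Beq Ceq] : [/\ A = 0, B = 0 & C = 0].
  by have : A + B + C = 0 := ex0; split; lra.
(* At m = n both tails are empty and the identity reads e = 0; it comes from the second penalty,
   since [margin n] is then positive. *)
have tailP m : (m <= n)%N -> beta m < K ->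
    tail r m + e = pos_part (tail x m - q).
  rewrite leq_eqVlt => /predU1P[->|mn] bK.
    move/eqP: Beq; rewrite mulf_eq0 tail_n_q tail_n add0r => /orP[|/eqP//].
    by rewrite /margin pos_part_id; [move/eqP|]; lra.
  have /eqP := psumr_eq0P C_ge0 Ceq (i := Ordinal mn) isT.
  rewrite mulf_eq0 /= => /orP[|/eqP]; last by lra.
  by have := margin_lt (Ordinal mn) bK; rewrite /=; lra.
move=> i; have bi := beta_incr _ (ltn_ord i).
split=> [bK|bK].
  have [bK'|bK'] := ltP (beta i.+1) K.
    rewrite mul1r layer_partE -(tailP i) ?(ltnW (ltn_ord i)) ?(lt_trans bi)//.
    rewrite -(tailP i.+1)//.
    by rewrite tailS; lra.
  rewrite mul0r; have /eqP := psumr_eq0P A_ge0 Aeq (i := i) isT.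
  rewrite mulf_eq0 => /orP[|/eqP//].
  by rewrite pos_part_id ?subr_ge0// subr_eq0 (negbTE bK).
(* When beta_{i+1} = K only the identity at i is available; it bounds [r i] because the rest of the
   tail and e are nonnegative. *)
have /andP[r0 rxi] := rx i; rewrite r0/= /layer_part le_min rxi andbT.
rewrite -tailP; [|exact: ltnW|by rewrite -bK].
rewrite tailS; have : 0 <= tail r i.+1.
  by apply: tail_ge0 => j; case/andP: (rx j).
lra.
Qed.

Lemma layered_excess_eq0 r : layered x q r -> excess x r q = 0.
Proof.
move=> lr; set e := retained x r q.
have rl i := layered_bound r i lr.
(* All risks before m are priced below [K], hence ceded as full layers, and these telescope. *)
have tailP m : (m <= n)%N -> beta m < K ->
    tail r 0 - tail r m = pos_part (tail x 0 - q) - pos_part (tail x m - q).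
  elim: m => [|m ih] mn bK; first by rewrite !subrr.
  have bK' : beta m < K by apply: lt_trans bK; exact: beta_incr.
  have := ih (ltnW mn) bK'.
  have [+ _] := lr (Ordinal mn); rewrite layer_partE /= bK mul1r (lt_eqF bK).
  by move=> /(_ isT); have := tailS r (Ordinal mn); rewrite /=; lra.
(* The full layers sum to the stop loss of the total, so the ceded amount never exceeds it and the
   positive part in e splits. *)
have e_eq : e = pos_part (tail x 0 - q) - tail r 0.
  have r0 : 0 <= tail r 0 by apply: tail_ge0 => i; case/andP: (rl i).
  have r1 : tail r 0 <= pos_part (tail x 0 - q).
    by rewrite -sum_layer_part tail0 ler_sum// => i _; case/andP: (rl i).
  rewrite /e /retained sumrB -!tail0.
  have [h|h] := leP 0 (tail x 0 - q).
    by rewrite (pos_part_id _ h) in r1 *; rewrite pos_part_id; lra.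
  rewrite (pos_part_eq0 (tail x 0 - q)) ?(ltW h)// in r1 *.
  by rewrite pos_part_eq0; lra.
rewrite /excess -/e big1 ?add0r; last first.
  move=> i _; have [h|h] := leP (beta i.+1) K.
    by rewrite pos_part_eq0 ?mul0r// subr_le0.
  by have [-> ] := lr i; rewrite ?gt_eqF// ltNge (ltW h) mul0r mulr0.
rewrite big1 ?addr0.
  have [bK|bK] := ltP (beta n) K; last first.
    by rewrite /margin pos_part_eq0 ?mul0r// subr_le0.
  by have := tailP n (leqnn n) bK; rewrite tail_n_q tail_n e_eq => h; nra.
move=> i _; have [bK|bK] := ltP (beta i) K; last first.
  have bi := beta_incr _ (ltn_ord i).
  rewrite /margin (pos_part_eq0 (K - beta i)) ?subr_le0//.
  by rewrite (pos_part_eq0 (K - beta i.+1)) ?subrr ?mul0r//; lra.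
have := tailP i (ltnW (ltn_ord i)) bK; rewrite e_eq => h.
by rewrite (_ : _ - pos_part (tail x i - q) = 0) ?mulr0//; lra.
Qed.

End bounds.

End allocation.

(** * Real-valued integrals and almost sure inequalities *)

Section Rintegral_complements.
Context d (T : measurableType d) (R : realType) (P : probability T R).
Implicit Types f g : T -> R.
Local Notation integrableR f := (P.-integrable [set: T] (fun w => (f w)%:E)).

Lemma integrableR_D f g : integrableR f -> integrableR g ->
  integrableR (fun w => f w + g w).
Proof. exact: integrableD. Qed.

Lemma integrableR_B f g : integrableR f -> integrableR g ->
  integrableR (fun w => f w - g w).
Proof. exact: integrableB. Qed.

Lemma integrableR_Z k f : integrableR f -> integrableR (fun w => k * f w).
Proof. exact: integrableZl. Qed.

Lemma integrableR_cst k : integrableR (fun=> k).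
Proof. exact: finite_measure_integrable_cst. Qed.

Lemma integrableR_sum (I : finType) (p : pred I) (F : I -> T -> R) :
  (forall i, p i -> integrableR (F i)) -> integrableR (fun w => \sum_(i | p i) F i w).
Proof.
move=> iF; under eq_fun do rewrite -sumEFin.
exact: integrable_sum.
Qed.

Lemma measurable_integrableR f : integrableR f -> measurable_fun [set: T] f.
Proof. by move=> /measurable_int/measurable_EFinP. Qed.

Lemma integrableR_pos_part f : integrableR f -> integrableR (fun w => pos_part (f w)).
Proof.
move=> fint; have mf := measurable_integrableR _ fint.
apply: le_integrable fint => //=; first exact/measurable_EFinP/measurable_maxr.
move=> w _; rewrite lee_fin /pos_part ger0_norm ?le_max ?lexx ?orbT//.
by rewrite ge_max normr_ge0 ler_norm.
Qed.

Lemma ae_le_integrableR f g : measurable_fun [set: T] f ->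
  {ae P, forall w, 0 <= f w <= g w} -> integrableR g -> integrableR f.
Proof.
move=> mf fg /integrableP[mg gfin]; apply/integrableP; split.
  exact/measurable_EFinP.
apply: le_lt_trans gfin; apply: ae_ge0_le_integral => //.
- by apply: measurableT_comp => //; exact/measurable_EFinP.
- exact: measurableT_comp.
apply: filterS fg => w /andP[f0 fg] _; rewrite !gee0_abs ?lee_fin//.
exact: le_trans fg.
Qed.

Lemma Rintegral_fineK f : integrableR f ->
  (\int[P]_w f w)%R%:E = (\int[P]_w (f w)%:E)%E.
Proof. by move=> fint; rewrite /Rintegral fineK// integrable_fin_num. Qed.

Lemma Rintegral_sum (I : finType) (F : I -> T -> R) :
  (forall i, integrableR (F i)) ->
  \int[P]_w (\sum_i F i w) = \sum_i \int[P]_w F i w.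
Proof.
move=> iF; rewrite [LHS]/Rintegral; under eq_integral do rewrite -sumEFin.
rewrite integral_sum//; under eq_bigr do rewrite -Rintegral_fineK//.
by rewrite sumEFin.
Qed.

(** This trades almost sure nonnegativity for nonnegativity everywhere. *)
Let Rintegral_pos_part f : integrableR f -> {ae P, forall w, 0 <= f w} ->
  \int[P]_w f w = \int[P]_w pos_part (f w).
Proof.
move=> fint f0; congr fine; apply: ae_eq_integral => //.
- exact: (measurable_int P).
- exact: (measurable_int P (integrableR_pos_part _ fint)).
- by apply: filterS f0 => w f0 _; rewrite pos_part_id.
Qed.

Lemma ae_Rintegral_ge0 f : integrableR f -> {ae P, forall w, 0 <= f w} ->
  0 <= \int[P]_w f w.
Proof.
move=> fint f0; rewrite Rintegral_pos_part//.
by apply: Rintegral_ge0 => w _; exact: pos_part_ge0.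
Qed.

Lemma ae_Rintegral_eq0 f : integrableR f -> {ae P, forall w, 0 <= f w} ->
  \int[P]_w f w <= 0 -> {ae P, forall w, f w = 0}.
Proof.
move=> fint f0 If.
have pint := integrableR_pos_part _ fint.
have mp : measurable_fun [set: T] (fun w => (pos_part (f w))%:E).
  exact: (measurable_int P pint).
have : ae_eq P [set: T] (fun w => (pos_part (f w))%:E) (cst 0%E).
  apply/(ae_eq_integral_abs P measurableT mp).
  under eq_integral do rewrite gee0_abs ?lee_fin ?pos_part_ge0//.
  rewrite -Rintegral_fineK// -Rintegral_pos_part//; congr _%:E.
  by apply/eqP; rewrite eq_le If/= ae_Rintegral_ge0.
move: f0; apply: filterS2 => w fw0 /(_ I)[].
by rewrite pos_part_id.
Qed.

Lemma ae_Rintegral0 f : integrableR f -> {ae P, forall w, f w = 0} ->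
  \int[P]_w f w = 0.
Proof.
move=> fint f0; rewrite /Rintegral (ae_eq_integral (cst 0%E)) ?integral0//.
- exact: (measurable_int P).
- by apply: filterS f0 => w -> _.
Qed.

Lemma Rintegral_indic (A : set T) : measurable A -> \int[P]_w (\1_A w) = fine (P A).
Proof. by move=> mA; rewrite /Rintegral integral_indic// setIT. Qed.

End Rintegral_complements.

(** * One-sided slopes of the stop-loss transform *)

Section stoploss.
Context d (T : measurableType d) (R : realType) (P : probability T R).
Variable S : T -> R.
Hypothesis Sint : P.-integrable [set: T] (fun w => (S w)%:E).

Let mS : measurable_fun [set: T] S. Proof. exact: measurable_integrableR Sint. Qed.

Lemma integrable_pos_partB (q : R) :
  P.-integrable [set: T] (fun w => (pos_part (S w - q))%:E).
Proof. by apply/integrableR_pos_part/integrableR_B => //; exact: integrableR_cst. Qed.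

Lemma measurable_ge_set (q : R) : measurable [set w | q <= S w].
Proof. by rewrite -[X in measurable X]setTI; exact: measurable_fun_le. Qed.

Lemma measurable_gt_set (q : R) : measurable [set w | q < S w].
Proof.
rewrite (_ : [set w | _] = ~` [set w | S w <= q]).
  apply: measurableC; rewrite -[X in measurable X]setTI.
  exact: measurable_fun_le.
by apply/seteqP; split => w /=; rewrite ltNge => /negP.
Qed.

(** Pathwise the decrease is at most q - p, and it is zero unless S > p. *)
Lemma stoploss_decrease_le (p q : R) : p <= q ->
  \int[P]_w pos_part (S w - p) - \int[P]_w pos_part (S w - q) <=
  (q - p) * fine (P [set w | p < S w]).
Proof.
move=> pq; have mA := measurable_gt_set p.
rewrite -RintegralB ?integrable_pos_partB// -Rintegral_indic//.
rewrite -RintegralZl//; last exact: integrable_indic.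
apply: le_Rintegral => //.
- by apply: integrableR_B; exact: integrable_pos_partB.
- by apply: integrableR_Z; exact: integrable_indic.
move=> w _; rewrite indicE; have [Sp|Sp] := leP (S w) p.
  by rewrite memNset/= ?ltNge ?Sp// !pos_part_eq0; lra.
rewrite mem_set//= mulr1 (pos_part_id (S w - p)); last by lra.
by have := pos_part_ge (S w - q); lra.
Qed.

(** Pathwise the decrease equals q - p once S >= q, and it is nonnegative otherwise. *)
Lemma stoploss_decrease_ge (p q : R) : p <= q ->
  (q - p) * fine (P [set w | q <= S w]) <=
  \int[P]_w pos_part (S w - p) - \int[P]_w pos_part (S w - q).
Proof.
move=> pq; have mA := measurable_ge_set q.
rewrite -RintegralB ?integrable_pos_partB// -Rintegral_indic//.
rewrite -RintegralZl//; last exact: integrable_indic.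
apply: le_Rintegral => //.
- by apply: integrableR_Z; exact: integrable_indic.
- by apply: integrableR_B; exact: integrable_pos_partB.
move=> w _; rewrite indicE; have [Sq|Sq] := leP q (S w).
  by rewrite mem_set//= mulr1 !pos_part_id; lra.
rewrite memNset/= ?mulr0; last by rewrite leNgt Sq.
rewrite subr_ge0; apply: le_pos_part; lra.
Qed.

(** Continuity of the measure from below; the next lemma uses continuity from above. *)
Lemma cvg_ge_right (q : R) :
  fine (P [set w | q + k.+1%:R^-1 <= S w]) @[k --> \oo] -->
  fine (P [set w | q < S w]).
Proof.
apply: fine_cvg; rewrite fineK ?fin_num_measure//; last exact: measurable_gt_set.
rewrite (_ : [set w | q < S w] = \bigcup_k [set w | q + k.+1%:R^-1 <= S w]).
  apply: nondecreasing_cvg_mu.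
  - by move=> k; exact: measurable_ge_set.
  - by apply: bigcup_measurable => k _; exact: measurable_ge_set.
  - move=> k l kl; apply/subsetPset => w /=; apply: le_trans.
    by rewrite lerD2l lef_pV2 ?posrE// ler_nat.
apply/seteqP; split => w /=; last first.
  by move=> [k _ /=]; apply: lt_le_trans; rewrite ltrDl.
(* Archimedean witness: [k.+1] exceeds 1 / (S w - q). *)
move=> qS; exists (Num.truncn (S w - q)^-1) => //=.
rewrite -lerBrDl invf_ple ?posrE ?subr_gt0//.
exact/ltW/truncnS_gt.
Qed.

Lemma cvg_gt_left (q : R) :
  fine (P [set w | q - k.+1%:R^-1 < S w]) @[k --> \oo] -->
  fine (P [set w | q <= S w]).
Proof.
apply: fine_cvg; rewrite fineK ?fin_num_measure//; last exact: measurable_ge_set.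
rewrite (_ : [set w | q <= S w] = \bigcap_k [set w | q - k.+1%:R^-1 < S w]).
  apply: nonincreasing_cvg_mu.
  - by rewrite ltey_eq fin_num_measure//; exact: measurable_gt_set.
  - by move=> k; exact: measurable_gt_set.
  - by apply: bigcap_measurable => // k _; exact: measurable_gt_set.
  - move=> k l kl; apply/subsetPset => w /=; apply: le_lt_trans.
    by rewrite lerD2l lerN2 lef_pV2 ?posrE// ler_nat.
apply/seteqP; split => w /=.
  by move=> qS k _ /=; apply: lt_le_trans qS; rewrite ltrBlDr ltrDl.
move=> h; rewrite leNgt; apply/negP => Sq.
have := h (Num.truncn (q - S w)^-1) I; rewrite /= ltNge => /negP; apply.
rewrite lerBrDl -lerBrDr invf_ple ?posrE ?subr_gt0//.
exact/ltW/truncnS_gt.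
Qed.

End stoploss.

(** * Quantiles and the Rockafellar-Uryasev formula *)

Section quantile.
Context d (T : measurableType d) (R : realType) (P : probability T R).
Variable Z : {RV P >-> R}.
Local Open Scope ereal_scope.

(** Galois connection between quantile and distribution function; right-continuity of the latter
    gives the forward implication. *)
Lemma VaR_leE t x : (VaR P t Z <= x%:E) = (t%:E <= cdf Z x).
Proof.
apply/idP/idP => [tx|tx]; last by apply: ereal_inf_lbound; exists x.
have rc : cdf Z y @[y --> x^'+] --> cdf Z x by exact: cdf_right_continuous.
rewrite -(cvg_lim _ rc)//; apply: lime_ge; first by apply/cvg_ex; exists (cdf Z x).
near=> y.
have : VaR P t Z < y%:E by rewrite (le_lt_trans tx)// lte_fin.
move=> /ereal_inf_lt[_ [z /= tz <-]]; rewrite lte_fin => zy.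
by rewrite (le_trans tz)// cdf_nondecreasing// ltW.
Unshelve. all: by end_near. Qed.

Lemma VaR_fin_num t : (0 < t < 1)%R -> VaR P t Z \is a fin_num.
Proof.
move=> /andP[t0 t1]; rewrite fin_numElt; apply/andP; split.
  have := cvg_cdfNy0 Z (open_ereal_lt' (_ : 0 < t%:E)).
  rewrite lte_fin => /(_ t0)[M [_ HM]].
  have := HM (M - 1)%R; rewrite gtrBl ltr01 => /(_ isT).
  by rewrite /= ltNge -VaR_leE -ltNge; apply: lt_trans; rewrite ltNyr.
have := cvg_cdfy1 Z (open_ereal_gt' (_ : t%:E < 1)).
rewrite lte_fin => /(_ t1)[M [_ HM]].
have := HM (M + 1)%R; rewrite ltrDl ltr01 => /(_ isT) /ltW.
by rewrite /= -VaR_leE => /le_lt_trans; apply; rewrite ltry.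
Qed.

Lemma VaR_nondecreasing s t : (s <= t)%R -> VaR P s Z <= VaR P t Z.
Proof.
move=> st; apply: ereal_inf_le_tmp => _ [x /= tx <-]; exists x => //=.
by rewrite (le_trans _ tx)// lee_fin.
Qed.

(** By [VaR_leE], VaR_t > x exactly when t > F(x), so preimages of half-lines are intervals. *)
Lemma measurable_fine_VaR :
  measurable_fun (`]0%R, 1%R[%classic : set (measurableTypeR R))
    (fun t => fine (VaR P t Z)).
Proof.
move=> _; apply: (measurability _ (RGenOInfty.measurableE R)) => //.
move=> /= _ [_ [x ->] <-].
rewrite (_ : _ `&` _ = `]0%R, 1%R[ `&` `]fine (cdf Z x), +oo[)%classic.
  exact: measurableI.
apply/seteqP; split => t /= [t01]; rewrite !in_itv/= !andbT => xt; split=> //.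
  rewrite ltNge -lee_fin fineK ?fin_num_measure// -VaR_leE.
  by rewrite -ltNge -[ltRHS]fineK ?VaR_fin_num.
rewrite ltNge -lee_fin fineK ?VaR_fin_num// VaR_leE.
by rewrite -ltNge -[ltLHS]fineK ?fin_num_measure.
Qed.

(* VaR_t(Z) with t uniform on ]0, 1[ has the law of Z: both sides have the    *)
(* same tail function.                                                        *)
Lemma integral_VaR_stoploss (q : R) :
  \int[lebesgue_measure]_(t in `]0%R, 1%R[)
     (pos_part (fine (VaR P t Z) - q))%:E =
  \int[P]_w (pos_part (Z w - q))%:E.
Proof.
pose stoploss := fun w => pos_part (Z w - q).
(* Extended by zero, since the quantile may be infinite outside the open interval. *)
pose Y := (fun t : measurableTypeR R => pos_part (fine (VaR P t Z) - q)) \_ `]0%R, 1%R[.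
have mY : measurable_fun [set: measurableTypeR R] Y.
  apply: (measurable_restrictT _ (measurable_itv `]0%R, 1%R[)).1.
  apply: measurable_maxr => //; apply: measurable_funB => //.
  exact: measurable_fine_VaR.
have Y0 t : (0 <= Y t)%R.
  by rewrite /Y patchE; case: ifPn => // _; rewrite /pos_part le_max lexx orbT.
have mS : measurable_fun [set: T] stoploss.
  by apply: measurable_maxr => //; exact: measurable_funB.
pose U := uniform_prob (@ltr01 R).
pose Y' : {RV U >-> R} := @mfun_Sub _ _ (measurableTypeR R) _ Y (mem_set mY).
pose S' : {RV P >-> R} := mfun_Sub (mem_set mS).
transitivity ('E_U[Y']).
  rewrite unlock integral_uniform; last 2 first.
  - exact/measurable_EFinP.
  - by move=> t; rewrite lee_fin.
  rewrite subr0 invr1 mul1e integral_itv_bndoo; last first.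
    exact/measurable_EFinP/measurable_funTS.
  by apply: eq_integral => t t01; rewrite /= /Y patchE t01.
transitivity ('E_P[S']); last by rewrite unlock.
(* Layer-cake formula: it remains to check that, at each level r >= 0, both variables exceed r with
   probability 1 - F(q + r). *)
rewrite !ge0_expectation_ccdf//; last first.
  by move=> w; rewrite /= /stoploss /pos_part le_max lexx orbT.
apply: eq_integral => r; rewrite inE/= in_itv/= andbT => r0.
set F := cdf Z (q + r)%R.
have F0 : 0 <= F by exact: cdf_ge0.
have F1 : F <= 1 by exact: cdf_le1.
have Ffin : F \is a fin_num by rewrite fin_num_measure.
transitivity (1 - F); last first.
  have <- := cdf_ccdf_1 Z (q + r)%R.
  rewrite -/F [F + _]addeC addeK//; congr (P _); apply/seteqP; split => w /=;
    rewrite !in_itv/= !andbT /stoploss /pos_part lt_max ltrBrDl.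
    by move=> ->.
  by rewrite (ltNge r 0%R) r0 orbF.
rewrite /ccdf /distribution /pushforward.
rewrite (_ : _ @^-1` _ = `]fine F, 1%R[%classic); last first.
  apply/seteqP; split => t /=; rewrite /Y patchE !in_itv/= !andbT.
    case: ifPn => [|_]; last by rewrite ltNge r0.
    rewrite inE/= in_itv/= => t01.
    rewrite /pos_part lt_max ltrBrDl (ltNge r 0%R) r0 orbF ltNge -lee_fin.
    rewrite fineK ?VaR_fin_num// VaR_leE -ltNge => h.
    by case/andP : t01 => _ ->; rewrite andbT -lte_fin fineK.
  move=> /andP[Ft t1].
  have t01 : (0 < t < 1)%R by rewrite t1 andbT (le_lt_trans _ Ft)// fine_ge0.
  rewrite ifT ?inE/= ?in_itv//= /pos_part lt_max; apply/orP; left.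
  rewrite ltrBrDl ltNge -lee_fin fineK ?VaR_fin_num// VaR_leE -ltNge.
  by rewrite -[ltLHS]fineK.
rewrite -[`]_, _[%classic]setIT -[LHS](integral_indic U)// integral_uniform//; last first.
  exact/measurable_EFinP.
rewrite subr0 invr1 mul1e integral_indic//=.
rewrite (_ : _ `&` _ = `]fine F, 1%R[)%classic; last first.
  apply/seteqP; split => t /=; rewrite !in_itv/=; first by case.
  move=> /andP[Ft t1]; split; first by rewrite Ft.
  by rewrite (ltW t1) andbT ltW// (le_lt_trans _ Ft)// fine_ge0.
rewrite lebesgue_measure_itv/= lte_fin.
have : (fine F <= 1)%R by rewrite -lee_fin fineK.
rewrite le_eqVlt => /predU1P[E1|->].
  by rewrite E1 ltxx -[F]fineK// E1 subee.
by rewrite EFinN fineK.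
Qed.

Lemma measurable_VaR (a : R) : (0 <= a)%R ->
  measurable_fun (`]a, 1%R[%classic : set (measurableTypeR R)) (VaR P ^~ Z).
Proof.
move=> a0; apply: (measurable_funS (measurable_itv `]0%R, 1%R[)).
  by apply: subset_itvr; rewrite bnd_simp.
have /measurable_EFinP := measurable_fine_VaR; apply: eq_measurable_fun => t.
by rewrite inE/= in_itv/= => t01; rewrite fineK ?VaR_fin_num.
Qed.

Hypothesis Zint : P.-integrable [set: T] (EFin \o Z).

Let integrable_stoploss (q : R) :
  P.-integrable [set: T] (fun w => (pos_part (Z w - q))%:E).
Proof. by apply: integrable_pos_partB; exact: Zint. Qed.

Section fixed_level.
Variable alpha : R.
Hypothesis alpha01 : (0 < alpha < 1)%R.

Let phi (t : measurableTypeR R) := fine (VaR P t Z).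

Let mphi : measurable_fun (`]alpha, 1%R[%classic : set (measurableTypeR R)) phi.
Proof.
apply: (measurable_funS (measurable_itv `]0%R, 1%R[)).
  by apply: subset_itvr; rewrite bnd_simp; case/andP: alpha01 => /ltW.
exact: measurable_fine_VaR.
Qed.

Let CVaR_phi : CVaR P alpha Z = ((1 - alpha)^-1)%:E *
  \int[lebesgue_measure]_(t in `]alpha, 1%R[) (phi t)%:E.
Proof.
have /andP[a0 a1] := alpha01.
rewrite /CVaR integral_itv_bndoo; last by apply: measurable_VaR; exact: ltW.
congr (_ * _); apply: eq_integral => t; rewrite inE/= in_itv/= => /andP[ta t1].
by rewrite /phi fineK// VaR_fin_num// t1 (lt_trans a0).
Qed.

Let stoploss_phi_mkcond (q : R) :
  \int[lebesgue_measure]_(t in `]alpha, 1%R[) (pos_part (phi t - q))%:E =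
  \int[lebesgue_measure]_(t in `]0%R, 1%R[)
    ((fun t => (pos_part (phi t - q))%:E) \_ `]alpha, 1%R[) t.
Proof.
rewrite -integral_mkcondr; congr integral; rewrite setIidr//.
by apply: subset_itvr; rewrite bnd_simp; case/andP: alpha01 => /ltW.
Qed.

Let stoploss_ge0 (q : R) (t : R) : 0 <= (pos_part (phi t - q))%:E.
Proof. by rewrite lee_fin /pos_part le_max lexx orbT. Qed.

(** Restricting to levels above [alpha] drops a nonnegative contribution. *)
Let stoploss_phi_le (q : R) :
  \int[lebesgue_measure]_(t in `]alpha, 1%R[) (pos_part (phi t - q))%:E <=
  \int[P]_w (pos_part (Z w - q))%:E.
Proof.
rewrite -integral_VaR_stoploss; apply: ge0_subset_integral => //.
  apply/measurable_EFinP/measurable_maxr => //; apply: measurable_funB => //.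
  exact: measurable_fine_VaR.
by apply: subset_itvr; rewrite bnd_simp; case/andP: alpha01 => /ltW.
Qed.

Let v := fine (VaR P alpha Z).

(** At q = v the dropped levels t <= alpha contribute nothing, because VaR_t <= v there. *)
Let stoploss_phi_VaR :
  \int[lebesgue_measure]_(t in `]alpha, 1%R[) (pos_part (phi t - v))%:E =
  \int[P]_w (pos_part (Z w - v))%:E.
Proof.
rewrite -integral_VaR_stoploss stoploss_phi_mkcond.
apply: eq_integral => t; rewrite inE/= in_itv/= patchE => t01.
case: ifPn => //; rewrite notin_setE/= in_itv/= => /negP.
have /andP[_ ->] := t01; rewrite andbT -leNgt => ta; apply/esym/congr1.
apply/max_idPr; rewrite subr_le0 fine_le ?VaR_fin_num//.
exact: VaR_nondecreasing.
Qed.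

(** Integrability comes from the finite bound E[(Z - q)_+]; taking q = v also controls [phi], which
    equals v + (phi - v)_+ above [alpha]. *)
Let phi_itv (q : R) :
  lebesgue_measure.-integrable `]alpha, 1%R[
    (fun t => q%:E + (pos_part (phi t - q))%:E) /\
  \int[lebesgue_measure]_(t in `]alpha, 1%R[) (q%:E + (pos_part (phi t - q))%:E)
  = (q * (1 - alpha))%:E +
    \int[lebesgue_measure]_(t in `]alpha, 1%R[) (pos_part (phi t - q))%:E.
Proof.
have /andP[_ a1] := alpha01.
have mu1 : lebesgue_measure (`]alpha, 1%R[%classic : set R) = (1 - alpha)%:E.
  by rewrite lebesgue_measure_itv/= lte_fin a1.
have ic : lebesgue_measure.-integrable `]alpha, 1%R[ (fun=> q%:E).
  apply/integrableP; split=> //.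
  by rewrite integral_cst//= mu1 -EFinM ltry.
have ip : lebesgue_measure.-integrable `]alpha, 1%R[
    (fun t => (pos_part (phi t - q))%:E).
  apply/integrableP; split.
    by apply/measurable_EFinP/measurable_maxr => //; exact: measurable_funB.
  under eq_integral do rewrite gee0_abs//.
  rewrite (le_lt_trans (stoploss_phi_le q))// ltey_eq.
  by rewrite integrable_fin_num//; exact: integrable_stoploss.
split; first exact: integrableD.
by rewrite integralD// integral_cst//= mu1 -EFinM.
Qed.

Let phi_split t : t \in (`]alpha, 1%R[%classic : set R) ->
  (phi t)%:E = v%:E + (pos_part (phi t - v))%:E.
Proof.
rewrite inE/= in_itv/= => /andP[ta t1].
have t01 : (0 < t < 1)%R by rewrite t1 (lt_trans _ ta)//; case/andP: alpha01.
rewrite -EFinD /pos_part; congr _%:E; rewrite (max_idPl _) ?subrKC//.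
by rewrite subr_ge0 fine_le ?VaR_fin_num//; exact: VaR_nondecreasing (ltW ta).
Qed.

Let integral_phi :
  \int[lebesgue_measure]_(t in `]alpha, 1%R[) (phi t)%:E =
  \int[lebesgue_measure]_(t in `]alpha, 1%R[) (v%:E + (pos_part (phi t - v))%:E).
Proof. by apply: eq_integral => t /phi_split. Qed.

Let stoploss_rescale (q : R) :
  (q + (1 - alpha)^-1 * \int[P]_w (pos_part (Z w - q)))%:E =
  (1 - alpha)^-1%:E *
    ((q * (1 - alpha))%:E + \int[P]_w (pos_part (Z w - q))%:E).
Proof.
have /andP[_ a1] := alpha01.
rewrite -[X in _ = _ * (_ + X)]fineK; last first.
  by rewrite integrable_fin_num//; exact: integrable_stoploss.
rewrite -EFinD -EFinM mulrDr mulrCA mulVf ?mulr1//.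
by rewrite subr_eq0 gt_eqF.
Qed.

Lemma CVaR_stoploss : CVaR P alpha Z =
  (v + (1 - alpha)^-1 * \int[P]_w (pos_part (Z w - v)))%:E.
Proof.
by rewrite CVaR_phi integral_phi (phi_itv v).2 stoploss_phi_VaR stoploss_rescale.
Qed.

(** Integrate phi <= q + (phi - q)_+ over levels above [alpha], then bound the last integral by the
    full stop loss. *)
Lemma CVaR_le_stoploss (q : R) :
  CVaR P alpha Z <= (q + (1 - alpha)^-1 * \int[P]_w (pos_part (Z w - q)))%:E.
Proof.
have /andP[_ a1] := alpha01.
rewrite stoploss_rescale.
rewrite CVaR_phi lee_pmul2l ?lte_fin ?invr_gt0 ?subr_gt0//.
apply: le_trans (leeD2l _ (stoploss_phi_le q)).
rewrite -(phi_itv q).2 integral_phi; apply: le_integral => //.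
- exact: (phi_itv v).1.
- exact: (phi_itv q).1.
move=> t /phi_split <-; rewrite -EFinD lee_fin -lerBlDl.
by rewrite /pos_part le_max lexx.
Qed.

End fixed_level.

End quantile.

(** * Monotonicity and sign of quantiles *)

Section VaR_order.
Context d (T : measurableType d) (R : realType) (P : probability T R).
Local Open Scope ereal_scope.

(** Up to a null set, Z <= x implies Y <= x, so the distribution function of Y dominates. *)
Lemma ae_le_VaR (Y Z : {RV P >-> R}) t :
  {ae P, forall w, (Y w <= Z w)%R} -> VaR P t Y <= VaR P t Z.
Proof.
move=> [N [mN N0 YZ]]; apply: ereal_inf_le_tmp => _ [x /= tx <-]; exists x => //=.
apply: le_trans tx _; rewrite /cdf /distribution /pushforward.
have mY : measurable (Y @^-1` `]-oo, x]) by exact: measurable_funPTI.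
have mZ : measurable (Z @^-1` `]-oo, x]) by exact: measurable_funPTI.
rewrite -(measureU0 mY mN N0); apply: le_measure; rewrite ?inE//.
  exact: measurableU.
move=> w /=; rewrite !in_itv/= => Zx.
have [YZw|YZw] := leP (Y w) (Z w); first by left; exact: le_trans Zx.
by right; apply: YZ => /=; rewrite leNgt YZw.
Qed.

Lemma VaR_ge0 (Z : {RV P >-> R}) t : (0 < t)%R ->
  {ae P, forall w, (0 <= Z w)%R} -> 0 <= VaR P t Z.
Proof.
move=> t0 [N [mN N0 ZN]]; apply: le_ereal_inf_tmp => _ [x /= tx <-].
rewrite lee_fin leNgt; apply/negP => x0.
have : P (Z @^-1` `]-oo, x]) = 0.
  apply: (subset_measure0 _ mN _ N0); first exact: measurable_funPTI.
  move=> w /=; rewrite in_itv/= => Zx; apply: ZN => /=.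
  by apply/negP; rewrite -ltNge (le_lt_trans Zx).
rewrite /cdf /distribution /pushforward in tx.
by move=> F0; move: tx; rewrite F0 lee_fin leNgt t0.
Qed.

End VaR_order.

(** * The convex function J and its one-sided derivatives *)

Section reinsurance.
Context d (T : measurableType d) (R : realType) (P : probability T R).
Variables (n : nat) (X : 'I_n -> {RV P >-> R}) (beta : nat -> R).
Variables (alpha lambda : R).
Hypothesis X_L1 : forall i, P.-integrable [set: T] (EFin \o X i).
Hypothesis X_ge0 : forall i, {ae P, forall w, 0 <= X i w}.
Hypothesis beta0 : beta 0%N = 0.
Hypothesis beta_incr : forall i, (i < n)%N -> beta i < beta i.+1.
Hypothesis alpha01 : 0 < alpha < 1.
Hypothesis lambda_gt0 : 0 < lambda.

Local Notation K := (cutoff alpha lambda).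
Local Notation margin := (margin beta K).
Local Notation J_minus := (Jminus X beta alpha lambda).
Local Notation J_plus := (Jplus X beta alpha lambda).
Implicit Types (Rs : 'I_n -> {RV P >-> R}) (p q : R).

Let K_gt0 : 0 < K.
Proof. by rewrite /cutoff divr_gt0// subr_gt0; case/andP: alpha01. Qed.

Let X_tail m w := tail (fun i => X i w) m.

Let X_tail_int m : P.-integrable [set: T] (fun w => (X_tail m w)%:E).
Proof. by apply: integrableR_sum => i _; exact: X_L1. Qed.

Let J q := lambda * q +
  \sum_(i < n) (margin i - margin i.+1) * \int[P]_w pos_part (X_tail i w - q).

Let J_plusE q : J_plus q = lambda -
  \sum_(i < n) (margin i - margin i.+1) * fine (P [set w | q < X_tail i w]).
Proof.
rewrite /Jplus addrC -sumrN; congr (_ + _); apply: eq_bigr => i _.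
by rewrite -mulNr opprB.
Qed.

Let J_minusE q : J_minus q = lambda -
  \sum_(i < n) (margin i - margin i.+1) * fine (P [set w | q <= X_tail i w]).
Proof.
rewrite /Jminus addrC -sumrN; congr (_ + _); apply: eq_bigr => i _.
by rewrite -mulNr opprB.
Qed.

Let margin_ge0 (i : 'I_n) : 0 <= margin i - margin i.+1.
Proof. by rewrite subr_ge0 margin_le. Qed.

(** The stop-loss bounds are summed with weights that are nonnegative because [beta] increases.
    Together with [J_slope_le] this is all the convexity of [J] that is needed. *)
Let J_slope_ge p q : p <= q -> (q - p) * J_plus p <= J q - J p.
Proof.
move=> pq; rewrite J_plusE mulrBr mulr_sumr.
have : \sum_(i < n) (margin i - margin i.+1) * \int[P]_w pos_part (X_tail i w - p) -
    \sum_(i < n) (margin i - margin i.+1) * \int[P]_w pos_part (X_tail i w - q) <=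
  \sum_(i < n) (q - p) * ((margin i - margin i.+1) * fine (P [set w | p < X_tail i w])).
  rewrite -sumrB; apply: ler_sum => i _; rewrite -mulrBr mulrCA ler_wpM2l//.
  exact: stoploss_decrease_le.
rewrite /J; lra.
Qed.

Let J_slope_le p q : p <= q -> J q - J p <= (q - p) * J_minus q.
Proof.
move=> pq; rewrite J_minusE mulrBr mulr_sumr.
have : \sum_(i < n) (q - p) *
    ((margin i - margin i.+1) * fine (P [set w | q <= X_tail i w])) <=
  \sum_(i < n) (margin i - margin i.+1) * \int[P]_w pos_part (X_tail i w - p) -
    \sum_(i < n) (margin i - margin i.+1) * \int[P]_w pos_part (X_tail i w - q).
  rewrite -sumrB; apply: ler_sum => i _; rewrite -mulrBr mulrCA ler_wpM2l//.
  exact: stoploss_decrease_ge.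
rewrite /J; lra.
Qed.

Let cvg_J_minus q : J_minus (q + k.+1%:R^-1) @[k --> \oo] --> J_plus q.
Proof.
rewrite J_plusE; under eq_cvg do rewrite J_minusE.
apply: cvgB; first exact: cvg_cst.
apply: cvg_big => [|i _]; first exact: add_continuous.
 apply: cvgM; first exact: cvg_cst.
exact: cvg_ge_right.
Qed.

Let cvg_J_plus q : J_plus (q - k.+1%:R^-1) @[k --> \oo] --> J_minus q.
Proof.
rewrite J_minusE; under eq_cvg do rewrite J_plusE.
apply: cvgB; first exact: cvg_cst.
apply: cvg_big => [|i _]; first exact: add_continuous.
 apply: cvgM; first exact: cvg_cst.
exact: cvg_gt_left.
Qed.

(** [J_minus] at q + 1/(k+1) dominates a nonnegative difference quotient and tends to [J_plus q]. *)
Let J_plus_ge0 q : (forall p, q <= p -> J q <= J p) -> 0 <= J_plus q.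
Proof.
move=> Jq; apply: (cvgr_to_ge (cvg_J_minus q)); apply: nearW => k.
have k0 : 0 < k.+1%:R^-1 :> R by [].
have := J_slope_le q (q + k.+1%:R^-1); rewrite lerDl ltW// => /(_ isT).
have := Jq (q + k.+1%:R^-1); rewrite lerDl ltW// => /(_ isT).
have -> : q + k.+1%:R^-1 - q = k.+1%:R^-1 by ring.
by rewrite -(pmulr_rge0 _ k0) => h; apply: le_trans; rewrite subr_ge0.
Qed.

Let J_minus_le0 q : 0 < q -> (forall p, 0 <= p -> J q <= J p) -> J_minus q <= 0.
Proof.
move=> q0 Jq; apply: (cvgr_to_le (cvg_J_plus q)); near=> k.
have k0 : 0 < k.+1%:R^-1 :> R by [].
(* Minimality is assumed only on p >= 0, so the left neighbour q - 1/(k+1) must stay nonnegative. *)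
have kq : k.+1%:R^-1 <= q.
  by apply/ltW; near: k; exact: (near_infty_natSinv_lt (PosNum q0)).
have := J_slope_ge (q - k.+1%:R^-1) q; rewrite gerBl ltW// => /(_ isT).
have := Jq (q - k.+1%:R^-1); rewrite subr_ge0 => /(_ kq).
have -> : q - (q - k.+1%:R^-1) = k.+1%:R^-1 by ring.
by rewrite -(pmulr_rle0 _ k0) => h /le_trans; apply; rewrite subr_le0.
Unshelve. all: by end_near. Qed.

(** * Cost of a treaty at a fixed threshold *)

Let net Rs : {RV P >-> R} := \sum_(i < n) (X i - Rs i).

Let netE Rs w : net Rs w = \sum_(i < n) (X i w - Rs i w).
Proof. by rewrite /net mfun_sum. Qed.

Let admissible_ae Rs : admissible X Rs ->
  {ae P, forall w, forall i, 0 <= Rs i w <= X i w}.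
Proof. by move=> adm; apply: filter_forall => i; exact: adm. Qed.

Let admissible_int Rs i : admissible X Rs ->
  P.-integrable [set: T] (fun w => (Rs i w)%:E).
Proof.
by move=> adm; apply: ae_le_integrableR (adm i) (X_L1 i).
Qed.

Let net_int Rs : admissible X Rs -> P.-integrable [set: T] (fun w => (net Rs w)%:E).
Proof.
move=> adm; under eq_fun do rewrite netE.
apply: integrableR_sum => i _; apply: integrableR_B; first exact: X_L1.
exact: admissible_int.
Qed.

Let cost Rs q := \sum_(i < n) beta i.+1 * \int[P]_w Rs i w + lambda * q +
  K * \int[P]_w pos_part (net Rs w - q).

Let objectiveE Rs : admissible X Rs -> objective X beta alpha lambda Rs =
  ((\sum_(i < n) beta i.+1 * \int[P]_w Rs i w)%:E +
   lambda%:E * CVaR P alpha (net Rs))%E.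
Proof.
move=> adm; rewrite /objective; congr (_ + _)%E.
rewrite -sumEFin; apply: eq_bigr => i _; rewrite EFinM unlock Rintegral_fineK//.
exact: admissible_int.
Qed.

Let objective_le Rs q : admissible X Rs ->
  (objective X beta alpha lambda Rs <= (cost Rs q)%:E)%E.
Proof.
move=> adm; rewrite objectiveE// /cost -addrA EFinD leeD2l//.
have -> : lambda * q + K * \int[P]_w pos_part (net Rs w - q) =
    lambda * (q + (1 - alpha)^-1 * \int[P]_w pos_part (net Rs w - q)).
  by rewrite /cutoff; ring.
rewrite EFinM lee_pmul2l ?lte_fin//.
by apply: CVaR_le_stoploss => //; exact: net_int.
Qed.

Let objective_VaR Rs : admissible X Rs ->
  objective X beta alpha lambda Rs = (cost Rs (fine (VaR P alpha (net Rs))))%:E.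
Proof.
move=> adm; rewrite objectiveE// /cost -addrA EFinD; congr (_ + _)%E.
rewrite CVaR_stoploss//; last exact: net_int.
by rewrite -EFinM; congr _%:E; rewrite /cutoff; ring.
Qed.

Let gap Rs q w := excess beta K (fun i => X i w) (fun i => Rs i w) q.

Let gapE Rs q w : gap Rs q w =
  \sum_(i < n) beta i.+1 * Rs i w + K * pos_part (net Rs w - q) -
  \sum_(i < n) (margin i - margin i.+1) * pos_part (X_tail i w - q).
Proof.
rewrite netE; have := @cost_excess R n beta K K_gt0 beta0
  (fun i => X i w) (fun i => Rs i w) q.
by rewrite /retained => ->; rewrite [X in X - _]addrC addrK.
Qed.

Let gap_int Rs q : admissible X Rs ->
  P.-integrable [set: T] (fun w => (gap Rs q w)%:E).
Proof.
move=> adm; under eq_fun do rewrite gapE.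
apply: integrableR_B; last first.
  apply: integrableR_sum => i _; apply: integrableR_Z.
  exact: integrable_pos_partB.
apply: integrableR_D.
  by apply: integrableR_sum => i _; apply: integrableR_Z; exact: admissible_int.
by apply: integrableR_Z; apply: integrable_pos_partB; exact: net_int.
Qed.

Let cost_gap Rs q : admissible X Rs -> cost Rs q = J q + \int[P]_w gap Rs q w.
Proof.
move=> adm.
have i1 : P.-integrable [set: T] (fun w => (\sum_(i < n) beta i.+1 * Rs i w)%:E).
  by apply: integrableR_sum => i _; apply: integrableR_Z; exact: admissible_int.
have i2 : P.-integrable [set: T] (fun w => (pos_part (net Rs w - q))%:E).
  by apply: integrable_pos_partB; exact: net_int.
have i3 : P.-integrable [set: T] (fun w =>
    (\sum_(i < n) (margin i - margin i.+1) * pos_part (X_tail i w - q))%:E).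
  apply: integrableR_sum => i _; apply: integrableR_Z.
  exact: integrable_pos_partB.
under eq_Rintegral do rewrite gapE.
rewrite RintegralB//; last by apply: integrableR_D => //; exact: integrableR_Z.
rewrite RintegralD//; last exact: integrableR_Z.
rewrite RintegralZl// !Rintegral_sum; last 2 first.
- by move=> i; apply: integrableR_Z; exact: integrable_pos_partB.
- by move=> i; apply: integrableR_Z; exact: admissible_int.
rewrite (eq_bigr (fun i : 'I_n => beta i.+1 * \int[P]_w Rs i w)); last first.
  by move=> i _; rewrite RintegralZl//; exact: admissible_int.
rewrite [X in _ = _ + (_ - X)](eq_bigr (fun i : 'I_n => (margin i - margin i.+1) *
    \int[P]_w pos_part (X_tail i w - q))); last first.
  by move=> i _; rewrite RintegralZl//; exact: integrable_pos_partB.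
rewrite /cost /J; ring.
Qed.

Let gap_ge0 Rs q : admissible X Rs -> 0 <= q -> {ae P, forall w, 0 <= gap Rs q w}.
Proof.
move=> adm q0; apply: filterS (admissible_ae _ adm) => w Rw.
apply: excess_ge0 => // i; have /andP[] := Rw i; exact: le_trans.
Qed.

Let J_le_cost Rs q : admissible X Rs -> 0 <= q -> J q <= cost Rs q.
Proof.
move=> adm q0; rewrite cost_gap// lerDl ae_Rintegral_ge0//.
- exact: gap_int.
- exact: gap_ge0.
Qed.

Let total_lossE w : total_loss X w = tail (fun i => X i w) 0.
Proof. by rewrite /total_loss mfun_sum tail0. Qed.

Let layerE q i w : layer X q i w = layer_part (fun i => X i w) q i.
Proof. by rewrite /layer /layer_part tailE total_lossE tail0. Qed.

Let VaR_net_ge0 Rs : admissible X Rs -> (0 <= VaR P alpha (net Rs))%E.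
Proof.
move=> adm; apply: VaR_ge0; first by case/andP: alpha01.
apply: filterS (admissible_ae _ adm) => w Rw.
by rewrite netE sumr_ge0// => i _; rewrite subr_ge0; case/andP: (Rw i).
Qed.

Let VaR_net_le Rs : admissible X Rs ->
  (VaR P alpha (net Rs) <= VaR P alpha (total_loss X))%E.
Proof.
move=> adm; apply: ae_le_VaR; apply: filterS (admissible_ae _ adm) => w Rw.
rewrite netE total_lossE tail0 ler_sum// => i _.
by rewrite gerBl; case/andP: (Rw i).
Qed.

Let measurable_layer q i : measurable_fun [set: T] (layer X q i).
Proof.
apply: measurable_minr => //; apply: measurable_maxr => //.
apply: measurable_funB => //; apply: measurable_funB => //.
under eq_fun do rewrite -mfun_sum; exact: measurable_funP.
Qed.

(** A competitor attaining cost [J q]; a risk priced exactly [K] is not ceded, which is one of the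
    allowed choices. *)
Let layer_treaty q (i : 'I_n) : {RV P >-> R} :=
  mfun_Sub (mem_set (measurable_funM (measurable_cst
    ((beta i.+1 < K)%R%:R : R)) (measurable_layer q i))).

Definition layered_ae Rs q :=
  {ae P, forall w, layered beta K (fun i => X i w) q (fun i => Rs i w)}.

Lemma layered_aeP Rs q : layered_ae Rs q <->
  (forall i : 'I_n,
    (beta i.+1 != K ->
      {ae P, forall w, Rs i w = (beta i.+1 < K)%R%:R * layer X q i w}) /\
    (beta i.+1 = K -> {ae P, forall w, 0 <= Rs i w <= layer X q i w})).
Proof.
split=> [lay i|form].
  split=> bK; apply: filterS lay => w /(_ i)[neqK eqK].
    by rewrite layerE; exact: neqK.
  by rewrite layerE; exact: eqK.
apply: filter_forall => i; have [neqK eqK] := form i.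
have [bK|bK] := eqVneq (beta i.+1) K.
  by apply: filterS (eqK bK) => w; rewrite layerE; split=> // /eqP.
by apply: filterS (neqK bK) => w; rewrite layerE; split=> // /eqP; rewrite (negbTE bK).
Qed.

Let X_ge0_ae : {ae P, forall w, forall i, 0 <= X i w}.
Proof. by apply: filter_forall => i; exact: X_ge0. Qed.

Let layered_admissible Rs q : 0 <= q -> layered_ae Rs q -> admissible X Rs.
Proof.
move=> q0 lay i; move: X_ge0_ae lay; apply: filterS2 => w Xw lay.
have /andP[-> Rl] := layered_bound _ _ _ _ Xw _ i lay.
by apply: le_trans Rl _; case/andP: (layer_part_bound _ q Xw i).
Qed.

Let layered_cost Rs q : 0 <= q -> layered_ae Rs q -> cost Rs q = J q.
Proof.
move=> q0 lay; have adm := layered_admissible _ _ q0 lay.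
rewrite cost_gap// ae_Rintegral0 ?addr0//; first exact: gap_int.
move: X_ge0_ae lay; apply: filterS2 => w Xw lay.
exact: layered_excess_eq0.
Qed.

Let cost_layered Rs q : admissible X Rs -> 0 <= q -> cost Rs q <= J q ->
  layered_ae Rs q.
Proof.
move=> adm q0; rewrite cost_gap// gerDl => Ile0.
have : {ae P, forall w, gap Rs q w = 0}.
  apply: ae_Rintegral_eq0 => //; first exact: gap_int.
  exact: gap_ge0.
move: (admissible_ae _ adm); apply: filterS2 => w Rw; apply: excess_eq0_layered => //.
by move=> i; have /andP[] := Rw i; exact: le_trans.
Qed.

Let layer_treaty_layered q : 0 <= q -> layered_ae (layer_treaty q) q.
Proof.
move=> q0; apply: filterS X_ge0_ae => w Xw i; split=> bK /=.
  by rewrite layerE.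
by rewrite bK ltxx mul0r lexx/=; case/andP: (layer_part_bound _ q Xw i).
Qed.

(** A one-sided derivative of the right sign settles its side of q, and at an endpoint of the
    interval only one side remains. *)
Let first_order_min q : (0 <= q%:E <= VaR P alpha (total_loss X))%E ->
  first_order X beta alpha lambda q ->
  forall p, 0 <= p -> (p%:E <= VaR P alpha (total_loss X))%E -> J q <= J p.
Proof.
move=> /andP[]; rewrite lee_fin => q0 qv fo p p0 pv.
have right_min : q <= p -> 0 <= J_plus q -> J q <= J p.
  move=> qp Jq; rewrite -subr_ge0; apply: le_trans (J_slope_ge _ _ qp).
  by rewrite mulr_ge0// subr_ge0.
have left_min : p <= q -> J_minus q <= 0 -> J q <= J p.
  move=> pq Jq; rewrite -subr_le0; apply: le_trans (J_slope_le _ _ pq) _.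
  by rewrite mulr_ge0_le0// subr_ge0.
case: fo => [[_ /andP[Jm Jp]]|[q_eq Jp]|[q_eq Jm]].
- by have [qp|/ltW pq] := leP q p; [exact: right_min|exact: left_min].
- by apply: right_min => //; rewrite q_eq.
- by apply: left_min => //; rewrite -lee_fin q_eq.
Qed.

Let min_first_order q : (0 <= q%:E <= VaR P alpha (total_loss X))%E ->
  (forall p, 0 <= p -> J q <= J p) -> first_order X beta alpha lambda q.
Proof.
move=> /andP[]; rewrite lee_fin le_eqVlt => /predU1P[<- _|q0 qv] Jq.
  by apply: Or32; split=> //; apply: J_plus_ge0 => p; exact: Jq.
have Jm := J_minus_le0 _ q0 Jq.
move: qv; rewrite le_eqVlt => /predU1P[qv|qv]; first by apply: Or33.
apply: Or31; split; first by rewrite lte_fin q0.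
by rewrite Jm J_plus_ge0// => p qp; apply: Jq; exact: le_trans (ltW q0) qp.
Qed.

Lemma minimizersE : minimizers X beta alpha lambda =
  [set Rs | exists q : R,
    [/\ (0 <= q%:E <= VaR P alpha (total_loss X))%E,
        first_order X beta alpha lambda q & layered_ae Rs q]].
Proof.
have VaR_netK Rs : (fine (VaR P alpha (net Rs)))%:E = VaR P alpha (net Rs).
  by rewrite fineK// VaR_fin_num.
apply/seteqP; split=> Rs.
  (* At this threshold the cost of [Rs] equals its objective. *)
  move=> [adm opt]; exists (fine (VaR P alpha (net Rs))).
  have q_ge0 : 0 <= fine (VaR P alpha (net Rs)) by rewrite fine_ge0// VaR_net_ge0.
  have q_bnd : (0 <= (fine (VaR P alpha (net Rs)))%:E <=
      VaR P alpha (total_loss X))%E.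
    by rewrite lee_fin q_ge0 VaR_netK VaR_net_le.
  (* Optimality is tested against the layer treaty at p. Combined with J <= cost, the bound shows
     both that the threshold minimizes [J] and that the expected gap is zero. *)
  have cost_min p : 0 <= p -> cost Rs (fine (VaR P alpha (net Rs))) <= J p.
    move=> p0; have lay := layer_treaty_layered _ p0.
    have adm' := layered_admissible _ _ p0 lay.
    rewrite -(layered_cost _ _ p0 lay) -lee_fin -objective_VaR//.
    by apply: le_trans (opt _ adm') _; exact: objective_le.
  split=> //; last by apply: cost_layered => //; exact: cost_min.
  apply: min_first_order => // p p0.
  by apply: le_trans (cost_min _ p0); exact: J_le_cost.
move=> [q [q_bnd fo lay]].
have q0 : 0 <= q by case/andP: q_bnd.
have adm := layered_admissible _ _ q0 lay; split=> // Rs' adm'.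
(* With v the quantile of the net loss under [Rs'], which lies in [0, VaR(S)]: objective Rs <= cost
   Rs q = J q <= J v <= cost Rs' v = objective Rs'. *)
apply: le_trans (objective_le _ q adm) _; rewrite layered_cost// objective_VaR//.
have v0 : 0 <= fine (VaR P alpha (net Rs')) by rewrite fine_ge0// VaR_net_ge0.
rewrite lee_fin; apply: le_trans (J_le_cost _ _ adm' v0).
by apply: first_order_min => //; rewrite VaR_netK VaR_net_le.
Qed.

End reinsurance.

Theorem theorem3 (d : measure_display) (T : measurableType d) (R : realType)
    (P : probability T R) (n : nat) (X : 'I_n -> {RV P >-> R})
    (beta : nat -> R) (alpha lambda : R)
    (n_gt0 : (0 < n)%N)
    (X_L1 : forall i, P.-integrable [set: T] (EFin \o X i))
    (X_ge0 : forall i, {ae P, forall w, 0 <= X i w})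
    (beta0 : beta 0%N = 0)
    (beta_incr : forall i, (i < n)%N -> beta i < beta i.+1)
    (alpha01 : 0 < alpha < 1)
    (lambda_gt0 : 0 < lambda) :
  minimizers X beta alpha lambda =
  [set Rs : 'I_n -> {RV P >-> R} | exists q : R,
    [/\ (0 <= q%:E <= VaR P alpha (total_loss X))%E,
        first_order X beta alpha lambda q &
        forall i : 'I_n,
          (beta i.+1 != cutoff alpha lambda ->
            {ae P, forall w,
              Rs i w = (beta i.+1 < cutoff alpha lambda)%R%:R * layer X q i w}) /\
          (beta i.+1 = cutoff alpha lambda ->
            {ae P, forall w, 0 <= Rs i w <= layer X q i w})]].
Proof.
rewrite minimizersE//.
apply/seteqP; split=> Rs [q [? ? /layered_aeP ?]]; exists q; split=> //.
Qed.
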